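(* Let $G=(V,E)$ be a finite simple graph with a maximal independent set $U$ of vertices that satisfies the following two properties: (1) for any $u\in U$, the set of vertices $N(u)$ forms a clique in $G$; (2) any vertex in $V\setminus U$ has exactly two neighbors in $U$. Let $T$ be a partial Coxeter element containing all toggles $\tau_u$ for $u\in U$. Then the triple $(\mathrm{Ind}(G),\mathrm{card},T)$ is $\frac{A}{2}$-mesic, where $A$ is the cardinality of $U$.
   Context: For a finite simple graph $G=(V,E)$ and $v\in V$, $N(v)$ is the set of neighbors of $v$ (not including $v$). $\mathrm{Ind}(G)$ is the set of all independent sets of $G$ (sets of pairwise nonadjacent vertices), and $\mathrm{card}(W)$ is the cardinality of $W\in\mathrm{Ind}(G)$. The toggle $\tau_v:\mathrm{Ind}(G)\to\mathrm{Ind}(G)$ is defined by $\tau_v(W)=W\setminus\{v\}$ if $v\in W$; $\tau_v(W)=W\cup\{v\}$ if $v\notin W$ and $W\cup\{v\}\in\mathrm{Ind}(G)$; and $\tau_v(W)=W$ otherwise. A partial Coxeter element is a composition $\tau_{v_1}\tau_{v_2}\cdots\tau_{v_k}$ with $v_1,\dots,v_k\in V$ pairwise distinct; it contains the toggles $\tau_{v_1},\dots,\tau_{v_k}$. For a finite set $X$, a function $f:X\to A'$ to a $\mathbb{Q}$-vector space, and a bijection $T:X\to X$, the triple $(X,f,T)$ is $c$-mesic if for every $T$-orbit $\mathcal{O}$ one has $\frac{1}{\#\mathcal{O}}\sum_{x\in\mathcal{O}}f(x)=c$. *)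

(* Defs.v *)
From mathcomp Require Import all_boot all_order all_algebra all_fingroup.

Set Implicit Arguments.
Unset Strict Implicit.
Unset Printing Implicit Defensive.

Import GRing.Theory.

(* A simple graph on V is given by a symmetric irreflexive adjacency
   relation e : rel V. *)
Definition nbr (V : finType) (e : rel V) (v : V) : {set V} :=
  [set w | e v w].

Definition clique (V : finType) (e : rel V) (A : {set V}) : Prop :=
  {in A &, forall x y, x != y -> e x y}.

Definition independent (V : finType) (e : rel V) (W : {set V}) : bool :=
  [forall x in W, forall y in W, ~~ e x y].

Definition Ind (V : finType) (e : rel V) : Type :=
  {W : {set V} | independent e W}.

Definition toggle_set (V : finType) (e : rel V) (v : V) (W : {set V})
    : {set V} :=
  if v \in W then W :\ v
  else if independent e (v |: W) then v |: W
  else W.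

Lemma toggle_set_independent (V : finType) (e : rel V) (v : V) (W : {set V}) :
  independent e W -> independent e (toggle_set e v W).
Proof.
rewrite /toggle_set; case: ifP => _ indW; last by case: ifP.
apply/forall_inP => x /setD1P [_ xW]; apply/forall_inP => y /setD1P [_ yW].
by move/forall_inP: indW => /(_ x xW) /forall_inP /(_ y yW).
Qed.

Definition toggle (V : finType) (e : rel V) (v : V) (W : Ind e) : Ind e :=
  exist _ (toggle_set e v (val W)) (toggle_set_independent v (valP W)).

Lemma toggleK (V : finType) (e : rel V) (v : V) :
  involutive (@toggle V e v).
Proof.
move=> [W indW]; apply: val_inj => /=.
rewrite {2}/toggle_set; have [vW | vW] := boolP (v \in W).
  by rewrite /toggle_set setD11 setD1K // indW.
case: ifP => ind_vW; first by rewrite /toggle_set setU11 setU1K.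
by rewrite /toggle_set (negbTE vW) ind_vW.
Qed.

Definition toggle_perm (V : finType) (e : rel V) (v : V) : {perm Ind e} :=
  perm (inv_inj (@toggleK V e v)).

(* A partial Coxeter element when s is duplicate-free.  The last entry of s acts
   first; permutations multiply left to right, hence the reversal. *)
Definition partial_coxeter (V : finType) (e : rel V) (s : seq V) : {perm Ind e} :=
  (\prod_(v <- rev s) toggle_perm e v)%g.

Lemma partial_coxeterE (V : finType) (e : rel V) (s : seq V) :
  partial_coxeter e s =1 foldr (fun v f => @toggle V e v \o f) id s.
Proof.
elim: s => [|v s IHs] W; first by rewrite /partial_coxeter big_nil perm1.
by rewrite /partial_coxeter rev_cons big_rcons permM permE /= -IHs.
Qed.

Local Open Scope ring_scope.

Definition mesic (X : finType) (A : lmodType rat) (f : X -> A) (T : {perm X})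
    (c : A) : Prop :=
  forall O : {set X}, O \in porbits T ->
    (#|O|%:R)^-1 *: (\sum_(x in O) f x) = c.

(* rat^o is rat as a vector space over itself. *)
Definition card_ind (V : finType) (e : rel V) (W : Ind e) : rat^o :=
  #|val W|%:R.

(* Main.v *)
Require Import Defs.
From mathcomp Require Import all_boot all_order all_algebra all_fingroup.
Set Implicit Arguments.
Unset Strict Implicit.
Unset Printing Implicit Defensive.
Local Open Scope ring_scope.

(** For [u] in [U], toggling [u] in an independent set [X] replaces [1_u(X)] by
    [1 - 1_u(X) - #(N(u) :&: X)], because [N(u)] is a clique.  Write
    [T = A tau_u B], with [B] acting first.  A vertex [w != u] is toggled in at
    most one of [A] and [B], so [1_w(B W)] is either [1_w(W)] or [1_w(T W)]; in
    both cases it has the same sum over a [T]-orbit as [1_w(W)].  Hence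
    [2 1_u + #(N(u) :&: W)] has average [1] on every orbit.  Summing this over
    [u] in [U] gives twice the cardinality, since every vertex outside [U] has
    two neighbors in [U]. *)

Section PartialCoxeter.
Variables (V : finType) (e : rel V).
Implicit Types (v w : V) (s : seq V) (W : Ind e).

Lemma mem_toggle_neq v w W :
  w != v -> (w \in val (toggle v W)) = (w \in val W).
Proof.
move=> wNv; rewrite /= /toggle_set; case: ifP => _; first by rewrite !inE wNv.
by case: ifP => // _; rewrite !inE (negPf wNv).
Qed.

Lemma mem_partial_coxeter_notin s w W :
  w \notin s -> (w \in val (partial_coxeter e s W)) = (w \in val W).
Proof.
rewrite partial_coxeterE; elim: s => //= v s IHs.
rewrite inE negb_or => /andP[wNv /IHs <-].
exact: mem_toggle_neq.
Qed.

Lemma partial_coxeter_cat s1 s2 W :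
  partial_coxeter e (s1 ++ s2) W
    = partial_coxeter e s1 (partial_coxeter e s2 W).
Proof. by rewrite /partial_coxeter rev_cat big_cat permM. Qed.

Lemma partial_coxeter_cons v s W :
  partial_coxeter e (v :: s) W = toggle v (partial_coxeter e s W).
Proof. by rewrite !partial_coxeterE. Qed.

End PartialCoxeter.

Lemma independent_setU1 (V : finType) (e : rel V) (e_sym : symmetric e)
    (e_irr : irreflexive e) (u : V) (W : {set V}) :
  independent e W -> independent e (u |: W) = (nbr e u :&: W == set0).
Proof.
move=> indW; apply/forall_inP/eqP => [ind_uW | N0].
  apply/setP => w; rewrite !inE; apply/negP => /andP[euw wW].
  have /forall_inP/(_ w) := ind_uW u (setU11 _ _).
  by rewrite euw setU1r // => /(_ isT).
have NuW w : w \in W -> ~~ e u w.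
  by move=> wW; apply/negP => euw; have /setP/(_ w) := N0; rewrite !inE euw wW.
move=> x /setU1P[->|xW]; apply/forall_inP => y /setU1P[->|yW].
- by rewrite e_irr.
- exact: NuW.
- by rewrite e_sym NuW.
- by have /forall_inP/(_ x xW)/forall_inP/(_ y yW) := indW.
Qed.

Lemma toggle_clique_count (V : finType) (e : rel V) (e_sym : symmetric e)
    (e_irr : irreflexive e) (u : V) (u_clique : clique e (nbr e u))
    (W : Ind e) :
  ((u \in val (toggle u W)) + (u \in val W) + #|nbr e u :&: val W| = 1)%N.
Proof.
case: W => W indW /=; have indP := independent_setU1 e_sym e_irr u indW.
rewrite /toggle_set; have [uW | uNW] := boolP (u \in W).
  (* Here [u |: W] is [W] itself, so the criterion [indP] leaves no neighbor of [u] in [W]. *)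
  have /eqP -> : nbr e u :&: W == set0 by rewrite -indP (setUidPr _) ?sub1set.
  by rewrite setD11 cards0.
rewrite indP; case: eqP => [-> | /eqP/set0Pn[w wNW]].
  by rewrite setU11 cards0.
(* Now [w] blocks [u]. Another neighbor of [u] in [W] would be adjacent to [w] by the clique
   property, against independence. *)
rewrite (negPf uNW); apply/eqP/cards1P; exists w.
apply/setP => x; rewrite inE; apply/idP/eqP => [xNW | -> //].
move: xNW wNW => /setIP[xN xW] /setIP[wN wW]; apply/eqP.
apply: contraLR (forall_inP indW x xW) => /(u_clique x w xN wN) exw.
by apply/forall_inP => /(_ w wW); rewrite exw.
Qed.

Lemma sum_porbit_perm (X : finType) (T : {perm X}) (O : {set X})
    (F : X -> nat) :
  O \in porbits T -> (\sum_(x in O) F (T x) = \sum_(x in O) F x)%N.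
Proof.
case/imsetP => y _ ->; rewrite [RHS](reindex_inj (@perm_inj _ T)) /=.
by apply: eq_bigl => x; rewrite -!eq_porbit_mem (porbit_perm T 1).
Qed.

Section OrbitCount.
Variables (V : finType) (e : rel V) (e_sym : symmetric e)
  (e_irr : irreflexive e) (s : seq V) (s_uniq : uniq s) (O : {set Ind e})
  (O_orbit : O \in porbits (partial_coxeter e s)).

Lemma sum_mem_suffix (s1 s2 : seq V) (w : V) : s = s1 ++ s2 ->
  (\sum_(W in O) (w \in val (partial_coxeter e s2 W))
     = \sum_(W in O) (w \in val W))%N.
Proof.
move=> def_s; have [ws2 | wNs2] := boolP (w \in s2); last first.
  by apply: eq_bigr => W _; rewrite mem_partial_coxeter_notin.
have wNs1 : w \notin s1.
  move: s_uniq; rewrite def_s cat_uniq => /and3P[_ /hasPn/(_ w ws2) + _].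
  exact.
(* Passing from [W] to its image leaves only the toggles of [s1] between the two sides, and these do
   not affect [w]. *)
rewrite -[RHS](sum_porbit_perm (fun W : Ind e => w \in val W : nat) O_orbit).
apply: eq_bigr => W _.
by rewrite def_s partial_coxeter_cat [in RHS]mem_partial_coxeter_notin.
Qed.

(** Double counting; a general [f] serves both the suffix [B] and the identity. *)
Lemma sum_card_setI (A : {set V}) (f : Ind e -> Ind e) :
  (\sum_(W in O) #|A :&: val (f W)|
     = \sum_(w in A) \sum_(W in O) (w \in val (f W)))%N.
Proof.
rewrite exchange_big; apply: eq_bigr => W _.
rewrite -sum1_card big_mkcond [RHS]big_mkcond.
by apply: eq_bigr => w _; rewrite inE; case: (w \in A); case: (w \in _).
Qed.

Lemma sum_clique_porbit (u : V) :
  u \in s -> clique e (nbr e u) ->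
  (\sum_(W in O) ((u \in val W) * 2 + #|nbr e u :&: val W|) = #|O|)%N.
Proof.
(* The equation is kept so that [s] can be cut both just before and just after [u]. *)
move=> us u_clique; case/splitPr def_s: _ / us => [s1 s2].
set B := partial_coxeter e s2.
have def_s' : s = rcons s1 u ++ s2 by rewrite cat_rcons.
have sumN : (\sum_(W in O) #|nbr e u :&: val (B W)|
    = \sum_(W in O) #|nbr e u :&: val W|)%N.
  rewrite sum_card_setI (sum_card_setI _ id); apply: eq_bigr => w _.
  exact: sum_mem_suffix def_s'.
(* Each 1 in the count of [O] is expanded by the toggle identity at [B W]. The cuts [def_s] and
   [def_s'] then reduce its two [u]-terms to the same orbit sum, whence the factor 2. *)
rewrite -sum1_card.
under [RHS]eq_bigr => W _ do
  rewrite -(toggle_clique_count e_sym e_irr u_clique (B W))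
          -partial_coxeter_cons.
rewrite !big_split /= sumN !(sum_mem_suffix _ def_s) (sum_mem_suffix _ def_s').
by rewrite -big_distrl /= muln2 addnn.
Qed.

End OrbitCount.

(** Count by [w] in [W]: if [w] lies in [U], its own term gives 2 and independence of [U] excludes
    neighbors there; otherwise its two neighbors in [U] give 2. *)
Lemma sum_closed_nbr (V : finType) (e : rel V) (e_sym : symmetric e)
    (U : {set V}) (U_ind : independent e U)
    (U_two : forall v : V, v \notin U -> #|nbr e v :&: U| = 2%N)
    (W : {set V}) :
  (\sum_(u in U) ((u \in W) * 2 + #|nbr e u :&: W|) = #|W| * 2)%N.
Proof.
have cardN u : #|nbr e u :&: W| = (\sum_(w in W) e u w)%N.
  rewrite -sum1_card big_mkcond [RHS]big_mkcond; apply: eq_bigr => w _.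
  by rewrite !inE andbC; case: (w \in W); case: (e u w).
under eq_bigr => u _ do rewrite cardN.
rewrite big_split /= exchange_big /=.
have -> : (\sum_(u in U) (u \in W) * 2 = \sum_(w in W) (w \in U) * 2)%N.
  rewrite big_mkcond [RHS]big_mkcond; apply: eq_bigr => w _.
  by case: (w \in W); case: (w \in U).
rewrite -big_split /= -sum_nat_const; apply: eq_bigr => w _.
have -> : (\sum_(u in U) e u w = #|nbr e w :&: U|)%N.
  rewrite -sum1_card big_mkcond [RHS]big_mkcond; apply: eq_bigr => u _.
  by rewrite !inE andbC e_sym; case: (u \in U); case: (e w u).
have [wU | /U_two -> //] := boolP (w \in U).
suff -> : nbr e w :&: U = set0 by rewrite cards0.
apply/setP => u; rewrite !inE; apply/negP => /andP[ewu uU].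
by have /forall_inP/(_ w wU)/forall_inP/(_ u uU) := U_ind; rewrite ewu.
Qed.

Theorem theorem7p6 (V : finType) (e : rel V)
    (e_sym : symmetric e) (e_irr : irreflexive e)
    (U : {set V}) (U_max : maxset (independent e) U)
    (U_clique : forall u : V, u \in U -> clique e (nbr e u))
    (U_two : forall v : V, v \notin U -> #|nbr e v :&: U| = 2%N)
    (s : seq V) (s_uniq : uniq s) (s_all : {subset U <= s}) :
  mesic (@card_ind V e) (partial_coxeter e s) (#|U|%:R / 2%:R : rat).
Proof.
move=> O O_orbit.
have sumO : (\sum_(W in O) #|val W| * 2 = #|U| * #|O|)%N.
  have U_ind := maxsetp U_max.
  under eq_bigr => W _ do rewrite -(sum_closed_nbr e_sym U_ind U_two).
  (* After the exchange each [u] in [U] contributes exactly [#|O|]. *)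
  rewrite exchange_big -sum_nat_const; apply: eq_bigr => u uU.
  exact: sum_clique_porbit (s_all _ uU) (U_clique _ uU).
have O_neq0 : (#|O|%:R : rat) != 0.
  rewrite Num.Theory.pnatr_eq0 cards_eq0; apply/set0Pn.
  by case/imsetP: O_orbit => W _ ->; exists W; apply: porbit_id.
(* Scaling in [rat^o] is multiplication, so clearing the denominators [#|O|] and 2 leaves [sumO]. *)
rewrite /card_ind -GRing.natr_sum /GRing.scale /=.
apply: (GRing.mulfI O_neq0); rewrite GRing.mulVKf //.
apply: (@GRing.mulIf _ (2%:R : rat)) => //.
by rewrite -GRing.mulrA GRing.mulfVK // -!GRing.natrM big_distrl sumO mulnC.
Qed.
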